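(* Let $q=2^r$ ($r\ge 1$), $\sigma\in\mathrm{Aut}(\mathbb{F}_q)$, and $R=\mathbb{F}_q[X;\sigma]/(X^2)$. Then there is no projective $\bigl((q^4-q)/2,\,q^2/2\bigr)$-arc in $\mathrm{PHG}(2,R)$; equivalently, $\mathrm{m}_{q^2/2}(R)<(q^4-q)/2$.
   Context: $\mathbb{F}_q[X;\sigma]$ is the skew polynomial ring with commutation rule $Xa=\sigma(a)X$; $R=\mathbb{F}_q[X;\sigma]/(X^2)$ is a chain ring of length $2$ and characteristic $2$ with residue field $\mathbb{F}_q$. The projective Hjelmslev plane $\mathrm{PHG}(2,R)$ is the incidence structure whose points are the free rank-$1$ submodules of the right module $R_R^3$, whose lines are the free rank-$2$ submodules of $R_R^3$, with incidence given by inclusion. A projective $(k,n)$-arc is a set of $k$ points meeting every line in at most $n$ points. For $0\le n\le q^2+q$, $\mathrm{m}_n(R)$ denotes the largest $k$ such that a projective $(k,n)$-arc exists in $\mathrm{PHG}(2,R)$. *)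

(* Defs.v *)
From HB Require Import structures.
From mathcomp Require Import all_boot all_order all_algebra all_field.
Set Implicit Arguments. Unset Strict Implicit. Unset Printing Implicit Defensive.
Import GRing.Theory.
Local Open Scope ring_scope.

(* The chain ring R = F[X; s]/(X^2): an element (a, b) : F * F stands for a + b X.
   Multiplication uses the commutation rule X a = s(a) X and X^2 = 0:
   (a + bX)(c + dX) = ac + (a d + b s(c)) X. *)
Definition Radd (F : fieldType) (u v : F * F) : F * F := (u.1 + v.1, u.2 + v.2).
Definition Rmul (F : fieldType) (s : F -> F) (u v : F * F) : F * F :=
  (u.1 * v.1, u.1 * v.2 + u.2 * s v.1).

Definition vec (F : finFieldType) := {ffun 'I_3 -> (F * F)%type}.

Definition vscale (F : finFieldType) (s : F -> F) (x : vec F) (r : F * F) : vec F :=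
  [ffun i => Rmul s (x i) r].
Definition vadd (F : finFieldType) (x y : vec F) : vec F :=
  [ffun i => Radd (x i) (y i)].

(* Points of PHG(2,R): free rank-1 submodules of R_R^3, i.e. images of
   injective R-linear maps R_R -> R_R^3, r |-> x r. *)
Definition is_point (F : finFieldType) (s : F -> F) (P : {set vec F}) : Prop :=
  exists x : vec F, injective (vscale s x) /\ P = [set vscale s x r | r : (F * F)%type].

(* Lines of PHG(2,R): free rank-2 submodules of R_R^3, i.e. images of
   injective R-linear maps R_R^2 -> R_R^3, (r1, r2) |-> x r1 + y r2. *)
Definition line_map (F : finFieldType) (s : F -> F) (x y : vec F)
  (rr : ((F * F) * (F * F))%type) : vec F :=
  vadd (vscale s x rr.1) (vscale s y rr.2).

Definition is_line (F : finFieldType) (s : F -> F) (L : {set vec F}) : Prop :=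
  exists x y : vec F, injective (line_map s x y) /\
    L = [set line_map s x y rr | rr : ((F * F) * (F * F))%type].

Definition is_proj_arc (F : finFieldType) (s : F -> F) (A : {set {set vec F}})
  (k n : nat) : Prop :=
  [/\ (forall P, P \in A -> is_point s P),
      #|A| = k &
      forall L, is_line s L -> (#|[set P in A | P \subset L]| <= n)%N].

(* Main.v *)
Require Import Defs.
From HB Require Import structures.
From mathcomp Require Import all_boot all_order all_algebra all_field.
From mathcomp Require Import mxabelem zify ring.
Set Implicit Arguments. Unset Strict Implicit. Unset Printing Implicit Defensive.
Import GRing.Theory.
Local Open Scope ring_scope.

(** Write [q = |F| = 2p].  Counting the lines through a point of the arc bounds
    the number of arc points in its neighbour class by [q (q - 1) / 2]; there are
    [q^2 + q + 1] classes, so the size of the arc forces equality everywhere.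
    Hence every line meets the arc in [0] or [q^2 / 2] points, the number of
    passants (lines missing the arc) is [q^2 + q + 1], and a point lies on [0] or
    [2] passants.  As [F] is a subring of [R], the points with coordinates in [F]
    form a subplane [PG(2, q)], which every line meets in [1] or [q + 1] points.
    Incidences between passants and subplane points are thus odd in number when
    counted by passants and even when counted by points.

    To avoid quotients, points and lines are counted through their [q (q - 1)]
    generating vectors and covectors. *)

(** * Counting solutions of linear systems over the residue field *)

Section LinearCounting.
Variable F : finFieldType.
Local Notation q := #|F|.

(** A right inverse [B] of [M] gives the particular solution [c *m B^T], so the solution set is a
    translate of the kernel of [M^T]. *)
Lemma card_affine_sol k n (M : 'M[F]_(k, n)) (c : 'rV_k) :
  row_free M -> #|[set u : 'rV_n | u *m M^T == c]| = (q ^ (n - k))%N.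
Proof.
move=> fM; have [B MB] := row_freeP fM.
have rM : \rank M^T = k by rewrite mxrank_tr; apply/eqP.
rewrite -[in RHS]rM -mxrank_ker -card_rowg.
have inj : injective (fun u : 'rV[F]_n => u - c *m B^T) by apply: addIr.
rewrite -[RHS](card_preimset _ inj); apply: eq_card => u.
rewrite !inE; apply/eqP/sub_kermxP; rewrite mulmxBl -mulmxA -trmx_mul MB trmx1 mulmx1.
  by move->; rewrite subrr.
by move/eqP; rewrite subr_eq0 => /eqP.
Qed.

Lemma row_free_rV n (v : 'rV[F]_n) : row_free v = (v != 0).
Proof. by rewrite /row_free rank_rV; case: (v != 0). Qed.

Lemma row_free_col2 n (x y : 'rV[F]_n) :
  x != 0 -> ~~ (y <= x)%MS -> row_free (col_mx x y).
Proof.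
move=> x0 yx; rewrite /row_free eqn_leq rank_leq_row /=.
have: (\rank x < \rank (col_mx x y))%N.
  rewrite -addsmxE ltn_neqAle mxrankS ?addsmxSl // andbT.
  rewrite (mxrank_leqif_eq (addsmxSl x y)) andbC.
  by apply: contra yx; rewrite addsmx_sub => /andP[/andP[_ ->]].
by rewrite rank_rV x0.
Qed.

Lemma submx_rV_sym n (x y : 'rV[F]_n) :
  x != 0 -> y != 0 -> (x <= y)%MS = (y <= x)%MS.
Proof.
move=> x0 y0; suff H (u v : 'rV[F]_n) : u != 0 -> (u <= v)%MS -> (v <= u)%MS.
  by apply/idP/idP; apply: H.
move=> u0 /sub_rVP[a Eu]; apply/sub_rVP; exists a^-1.
rewrite Eu scalerA mulVf ?scale1r //.
by apply: contra_neq u0 => a0; rewrite Eu a0 scale0r.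
Qed.

Lemma orth_submx n (x y a : 'rV[F]_n) :
  (y <= x)%MS -> a *m x^T = 0 -> a *m y^T = 0.
Proof. by case/sub_rVP=> c -> H; rewrite linearZ /= -scalemxAr H scaler0. Qed.

Lemma orthC n (u v : 'rV[F]_n) : (u *m v^T == 0) = (v *m u^T == 0).
Proof. by rewrite -[LHS]trmx_eq0 trmx_mul trmxK. Qed.

Lemma card_submx_rV n (x : 'rV[F]_n) : x != 0 -> #|[set y : 'rV_n | (y <= x)%MS]| = q.
Proof.
move=> x0; have := card_rowg x; rewrite rank_rV x0 expn1 => <-.
by apply: eq_card => y; rewrite !inE.
Qed.

Lemma card_setD0 n (P : pred 'rV[F]_n) : P 0 ->
  #|[set u | P u]| = #|[set u | (u != 0) && P u]|.+1.
Proof.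
move=> P0; rewrite [LHS](cardsD1 0) in_set P0 add1n; congr _.+1.
by apply: eq_card => u; rewrite !inE.
Qed.

Lemma card_orth1 (x : 'rV[F]_3) : x != 0 ->
  #|[set u : 'rV_3 | (u != 0) && (u *m x^T == 0)]| = (q ^ 2 - 1)%N.
Proof.
move=> x0; rewrite -row_free_rV in x0; have := card_affine_sol 0 x0.
by rewrite card_setD0 ?mul0mx // => <-; rewrite subn1.
Qed.

Lemma mul_col2 n (u x y : 'rV[F]_n) c d :
  (u *m (col_mx x y)^T == row_mx c d) = (u *m x^T == c) && (u *m y^T == d).
Proof.
rewrite tr_col_mx mul_mx_row; apply/eqP/andP.
  by case/eq_row_mx=> -> ->.
by case=> /eqP-> /eqP->.
Qed.

Lemma card_affine1 (x : 'rV[F]_3) c : x != 0 ->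
  #|[set u : 'rV_3 | u *m x^T == c]| = (q ^ 2)%N.
Proof. by rewrite -row_free_rV; apply: card_affine_sol. Qed.

Lemma card_affine2 (x y : 'rV[F]_3) c d : x != 0 -> ~~ (y <= x)%MS ->
  #|[set u : 'rV_3 | (u *m x^T == c) && (u *m y^T == d)]| = q.
Proof.
move=> x0 xy; have := card_affine_sol (row_mx c d) (row_free_col2 x0 xy).
by rewrite expn1 => <-; apply: eq_card => u; rewrite !inE mul_col2.
Qed.

Lemma card_orth2 (x y : 'rV[F]_3) : x != 0 -> ~~ (y <= x)%MS ->
  #|[set u : 'rV_3 | [&& u != 0, u *m x^T == 0 & u *m y^T == 0]]| = (q - 1)%N.
Proof.
move=> x0 xy; have := card_affine2 0 0 x0 xy.
by rewrite card_setD0 ?mul0mx ?eqxx // => <-; rewrite subn1.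
Qed.

End LinearCounting.

Lemma card_pair_set (A B : finType) (P : pred (A * B)) (Q : pred A) m :
  (forall u, Q u -> #|[set v | P (u, v)]| = m) ->
  (forall u v, P (u, v) -> Q u) ->
  #|[set w | P w]| = (#|[set u | Q u]| * m)%N.
Proof.
move=> Pm PQ; rewrite -!sum1dep_card big_distrl /=.
rewrite (eq_bigl (fun w : A * B => Q w.1 && P (w.1, w.2))); last first.
  by case=> u v /=; rewrite andbC; case E: (P _) => //=; rewrite (PQ u v).
rewrite -(pair_big_dep _ (fun u v => P (u, v)) (fun _ _ => 1%N)) /=.
by apply: eq_bigr => u Qu; rewrite sum1dep_card Pm // mul1n.
Qed.

(** * Incidence between covectors and vectors over the chain ring *)

Section Hjelmslev.
Variables (F : finFieldType) (s : {rmorphism F -> F}).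
Local Notation q := #|F|.
Local Notation W := ('rV[F]_3 * 'rV[F]_3)%type.
Local Notation "x ^s" := (map_mx s x) (at level 2, format "x ^s").

(* A pair [(x0, x1)] stands for the vector [x0 + x1 X] over [R]. *)
Definition unimod : {set W} := [set x | x.1 != 0].
(* The two components of the left-right product [a x = 0] over [R]. *)
Definition inc (a x : W) : bool :=
  (a.1 *m x.1^T == 0) && (a.1 *m x.2^T + a.2 *m (x.1^s)^T == 0).
Definition wact (x : W) (r : F * F) : W :=
  (r.1 *: x.1, r.2 *: x.1 + s r.1 *: x.2).
(** The condition [r.1 != 0] characterises the units of R, so on unimodular vectors this means
    generating the same point. *)
Definition same (x y : W) := [exists r : F * F, (r.1 != 0) && (y == wact x r)].
Definition joins (x y : W) := [set a in unimod | inc a x && inc a y].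

Lemma card_pencil y : y \in unimod ->
  #|[set a in unimod | inc a y]| = ((q ^ 2 - 1) * q ^ 2)%N.
Proof.
case: y => y0 y1; rewrite inE /= => ny.
rewrite -(card_orth1 ny).
rewrite (card_pair_set (Q := fun u => (u != 0) && (u *m y0^T == 0)) (m := (q ^ 2)%N)) //.
  move=> u /andP[u0 uy]; rewrite -(card_affine1 (- (u *m y1^T)) (x := y0^s)) ?map_mx_eq0 //.
  by apply: eq_card => v; rewrite !inE /inc /= u0 uy /= addrC addr_eq0.
by move=> u v; rewrite inE /inc /= => /andP[-> /andP[->]].
Qed.

(** The first component of [a] solves two independent homogeneous equations, and the second then
    solves two independent affine ones. The count is that of the generators of a single line. *)
Lemma card_joins_far x y : x \in unimod -> ~~ (y.1 <= x.1)%MS ->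
  #|joins x y| = ((q - 1) * q)%N.
Proof.
case: x y => x0 x1 [y0 y1]; rewrite inE /= => nx xy.
rewrite -(card_orth2 nx xy).
rewrite (card_pair_set (m := q)
  (Q := fun u => [&& u != 0, u *m x0^T == 0 & u *m y0^T == 0])) //.
  move=> u /and3P[u0 ux uy].
  rewrite -(card_affine2 (- (u *m x1^T)) (- (u *m y1^T)) (x := x0^s) (y := y0^s));
    rewrite ?map_mx_eq0 ?map_submx //.
  apply: eq_card => v; rewrite !inE /inc /= u0 ux uy /=.
  by rewrite ![u *m _ + _]addrC !addr_eq0.
by move=> u v; rewrite inE /inc /= => /andP[-> /andP[/andP[-> _] /andP[->]]].
Qed.

(** Incidence with [(x0, x1)] turns the term in [a.2] into [- s c] times [a.1 *m x1^T], so a second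
    incidence in the same neighbour class constrains [a.1] only. *)
Lemma inc_near x0 x1 y1 c a : inc a (x0, x1) ->
  inc a (c *: x0, y1) = (a.1 *m (y1 - s c *: x1)^T == 0).
Proof.
case: a => a0 a1 /andP[/= ax /eqP E]; rewrite /inc /=.
rewrite linearZ /= -scalemxAr (eqP ax) scaler0 eqxx /=.
rewrite map_mxZ [(y1 - _)^T]linearB /= [(s c *: x1)^T]linearZ
  [(s c *: _)^T]linearZ /= mulmxBr -!scalemxAr.
by move/eqP: E; rewrite addrC addr_eq0 => /eqP->; rewrite scalerN.
Qed.

Lemma card_joins_near x0 x1 y1 c : x0 != 0 -> ~~ (y1 - s c *: x1 <= x0)%MS ->
  #|joins (x0, x1) (c *: x0, y1)| = ((q - 1) * q ^ 2)%N.
Proof.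
move=> nx xy; rewrite -(card_orth2 nx xy).
rewrite (card_pair_set (m := (q ^ 2)%N)
  (Q := fun u => [&& u != 0, u *m x0^T == 0 & u *m (y1 - s c *: x1)^T == 0])) //.
  move=> u /and3P[u0 ux uz].
  rewrite -(card_affine1 (- (u *m x1^T)) (x := x0^s)) ?map_mx_eq0 //.
  apply: eq_card => v; rewrite !inE.
  have -> : inc (u, v) (x0, x1) = (v *m (x0^s)^T == - (u *m x1^T)).
    by rewrite /inc /= ux /= addrC addr_eq0.
  rewrite u0; case E: (_ == - _) => //=; rewrite (inc_near (x1 := x1)) ?uz //.
  by rewrite /inc /= ux /= addrC addr_eq0.
move=> u v; rewrite inE /= => /and3P[-> I]; have /andP[/= ux _] := I.
by rewrite (inc_near (x1 := x1)) // => ->; rewrite ux.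
Qed.

Lemma sameP x y : y \in unimod ->
  reflect (exists c d, y = (c *: x.1, d *: x.1 + s c *: x.2)) (same x y).
Proof.
rewrite inE => ny; apply: (iffP existsP) => [[[c d] /andP[_ /eqP ->]]|[c [d Ey]]].
  by exists c, d.
exists (c, d); rewrite /wact /= -Ey eqxx andbT.
by apply: contra_neq ny => c0; rewrite Ey /= c0 scale0r.
Qed.

(** The cases far, near but distinct, and equal are written as successive corrections, so that
    summing over an arc separates into three counts. *)
Lemma card_joins x y : x \in unimod -> y \in unimod ->
  #|joins x y| = (q * (q - 1) + (y.1 <= x.1)%MS * (q * (q - 1) ^ 2)
                  + same x y * (q ^ 3 * (q - 1)))%N.
Proof.
(* Replacing q by a successor removes the truncated subtractions before [nia]. *)
move=> nx ny; have [e Eq] : exists e, q = e.+1 by exists q.-1; rewrite prednK // (cardD1 0).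
have [yx|yx] := boolP (y.1 <= x.1)%MS; last first.
  case: (sameP x ny) => [[c [d E]]|_].
    by case/sub_rVP: yx; exists c; rewrite E.
  by rewrite card_joins_far // mulnC !addn0.
have [c Ec] := sub_rVP yx.
case: x y nx ny yx Ec => x0 x1 [y0 y1] /= nx ny yx Ec; subst y0.
have nx0 : x0 != 0 by move: nx; rewrite inE.
have ncx0 : c *: x0 != 0 by move: ny; rewrite inE.
have [/sub_rVP[d Ed]|nz] := boolP (y1 - s c *: x1 <= x0)%MS; last first.
  rewrite card_joins_near //.
  case: sameP => [||_]; rewrite ?inE //; last by rewrite Eq; nia.
  case=> c' [d [/eqP]]; rewrite -subr_eq0 -scalerBl scaler_eq0 (negPf nx0) orbF subr_eq0.
  move=> /eqP <- Ey1; case/sub_rVP: nz; exists d; rewrite Ey1 /=.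
  by rewrite addrK.
have Ey1 : y1 = d *: x0 + s c *: x1 by rewrite -Ed subrK.
case: sameP => [||[]]; rewrite ?inE //; last by exists c, d; rewrite Ey1.
move=> _; rewrite (_ : joins _ _ = [set a in unimod | inc a (x0, x1)]).
  by rewrite card_pencil // Eq; nia.
apply/setP=> a; rewrite !inE; case: (a.1 != 0) => //=.
case I: (inc a _) => //=; have /andP[/= ax _] := I.
by rewrite (inc_near (x1 := x1)) // Ey1 addrK linearZ /= -scalemxAr (eqP ax) scaler0 eqxx.
Qed.

Lemma wact_inj x : x \in unimod -> injective (wact x).
Proof.
rewrite inE => nx [c d] [c' d'] [/eqP].
rewrite -subr_eq0 -scalerBl scaler_eq0 (negPf nx) orbF subr_eq0 => /eqP <-.
move/addIr/eqP.
by rewrite -subr_eq0 -scalerBl scaler_eq0 (negPf nx) orbF subr_eq0 => /eqP <-.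
Qed.

Lemma card_units : #|[set r : F * F | r.1 != 0]| = (q * (q - 1))%N.
Proof.
rewrite (_ : [set _ | _] = setX [set~ 0] setT).
  by rewrite cardsX cardsT cardsC1 mulnC subn1.
by apply/setP=> r; rewrite !inE andbT.
Qed.

Lemma card_same x : x \in unimod -> #|[set y | same x y]| = (q * (q - 1))%N.
Proof.
move=> nx; rewrite -card_units -(card_imset _ (wact_inj nx)).
apply: eq_card => y; rewrite !inE; apply/existsP/imsetP.
  by case=> r /andP[r0 /eqP->]; exists r; rewrite ?inE.
by case=> r; rewrite inE => r0 ->; exists r; rewrite r0 eqxx.
Qed.

(** The covector is multiplied on the left by the unit 1 + dX, which does not affect whether a
    product vanishes. *)
Lemma inc_shift u w d x : inc (u, w + d *: u^s) x = inc (u, w) x.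
Proof.
rewrite /inc /=; case: eqP => //= ux.
by rewrite mulmxDl -scalemxAl map_trmx -map_mxM ux map_mx0 scaler0 addr0.
Qed.

(** * Extremal counting for an arc given by its generating vectors *)

Section Arc.
Variable K : {set W}.
Hypothesis Kunimod : K \subset unimod.
Hypothesis K_wact : forall x (r : F * F), r.1 != 0 -> (wact x r \in K) = (x \in K).

(** When [K] consists of all generators of the arc points, this is [q * (q - 1)] times the number of
    arc points on the line of [a]. *)
Definition hits (a : W) := #|[set x in K | inc a x]|.
(* Generating vectors of the arc points in the neighbour class of [v]. *)
Definition nbhd (v : 'rV[F]_3) := #|[set x in K | (x.1 <= v)%MS]|.
Definition passants : {set W} := [set a in unimod | hits a == 0%N].

Lemma sum_hits (D : {set W}) :
  (\sum_(a in D) hits a = \sum_(x in K) #|[set a in D | inc a x]|)%N.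
Proof.
under eq_bigr => a _ do rewrite /hits -sum1dep_card big_mkcondr /=.
rewrite exchange_big /=; apply: eq_bigr => x _.
by rewrite -big_mkcondr sum1dep_card.
Qed.

Lemma card_K_same y : y \in unimod ->
  #|[set x in K | same y x]| = ((y \in K) * (q * (q - 1)))%N.
Proof.
move=> ny; have sK x : same y x -> (x \in K) = (y \in K).
  by case/existsP=> r /andP[r0 /eqP->]; rewrite K_wact.
have [yK|yK] := boolP (y \in K).
  rewrite mul1n -(card_same ny); apply: eq_card => x; rewrite !inE.
  by case S: (same y x); rewrite ?andbF ?(sK _ S) ?yK.
apply/eqP; rewrite cards_eq0; apply/eqP/setP=> x; rewrite !inE.
by case S: (same y x); rewrite ?andbF ?(sK _ S) ?(negPf yK).
Qed.

(** Double counting with [card_joins]: its three terms contribute all of [K], the members of [K] in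
    the neighbour class of [y], and the generators of the point of [y]. *)
Lemma sum_hits_pencil y : y \in unimod ->
  (\sum_(a in [set a in unimod | inc a y]) hits a =
    q * (q - 1) * #|K| + q * (q - 1) ^ 2 * nbhd y.1
    + (y \in K) * (q ^ 4 * (q - 1) ^ 2))%N.
Proof.
move=> ny; rewrite sum_hits.
rewrite (eq_bigr (fun x => q * (q - 1) + (x.1 <= y.1)%MS * (q * (q - 1) ^ 2)
                  + same y x * (q ^ 3 * (q - 1))))%N; last first.
  move=> x xK; rewrite -card_joins ?ny ?(subsetP Kunimod _ xK) //.
  by apply: eq_card => a; rewrite !inE andbA.
rewrite !big_split /= sum_nat_const -!big_distrl /=.
have sum_bool (P : pred W) : (\sum_(x in K) P x = #|[set x in K | P x]|)%N.
  by rewrite -sum1dep_card big_mkcondr; apply: eq_bigr => x _; case: (P x).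
rewrite (sum_bool (fun x => (x.1 <= y.1)%MS)) (sum_bool (same y)) card_K_same //.
by rewrite /nbhd; case: (y \in K); ring.
Qed.

Lemma card_nonzero_rV : #|[set v : 'rV[F]_3 | v != 0]| = (q ^ 3 - 1)%N.
Proof.
rewrite -[in RHS](card_mx F 1 3) subn1 -(cardsC1 (0 : 'rV[F]_3)).
by apply: eq_card => v; rewrite !inE.
Qed.

Lemma card_unimod : #|unimod| = ((q ^ 3 - 1) * q ^ 3)%N.
Proof.
rewrite -card_nonzero_rV (card_pair_set (Q := fun v => v != 0) (m := (q ^ 3)%N)) //.
by move=> u u0; rewrite -(card_mx F 1 3) -cardsT; apply: eq_card => v; rewrite !inE.
Qed.

(** Each [x] in [K] is counted once for every nonzero multiple of [x.1]. *)
Lemma sum_nbhd :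
  (\sum_(v in [set v | v != 0%R]) nbhd v = #|K| * (q - 1))%N.
Proof.
under eq_bigr => v _ do rewrite /nbhd -sum1dep_card big_mkcondr /=.
rewrite exchange_big /= -sum_nat_const; apply: eq_bigr => x xK.
have := subsetP Kunimod _ xK; rewrite inE => nx.
rewrite -big_mkcondr sum1dep_card -(card_submx_rV nx) (card_setD0 (P := fun v => (v <= x.1)%MS) (sub0mx _ _)) subn1 /=.
apply: eq_card => v; rewrite !inE; case v0: (v == 0) => //=.
by rewrite submx_rV_sym ?v0.
Qed.

Hypothesis s_bij : bijective s.
Variable p : nat.
Hypothesis q_even : q = (2 * p)%N.
(** Up to the factor [q * (q - 1)] for generators, the size is (q^4 - q)/2, and the bound on line
    intersections below is q^2/2. *)
Hypothesis cardK : #|K| = (q * (q - 1) * (p * (q ^ 3 - 1)))%N.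
Hypothesis hits_le : forall a, a \in unimod -> (hits a <= q * (q - 1) * (q * p))%N.

(** A subtraction-free parametrisation, which turns the later identities into polynomial ones in
    [t]. *)
Lemma q_form : exists t, [/\ p = t.+1, q = (2 * t + 2)%N, (q - 1 = 2 * t + 1)%N,
  (q ^ 2 - 1 = (2 * t + 1) * (2 * t + 3))%N &
  (q ^ 3 - 1 = (2 * t + 1) * ((2 * t + 2) ^ 2 + (2 * t + 2) + 1))%N].
Proof.
have : (0 < q)%N by rewrite (cardD1 0).
rewrite q_even; case: p => // t _; exists t.
have -> : (2 * t.+1 = 2 * t + 2)%N by lia.
split=> //; first by lia.
  by apply/eqP; rewrite -(eqn_add2r 1) subnK ?expn_gt0 ?addn2 //; apply/eqP; ring.
by apply/eqP; rewrite -(eqn_add2r 1) subnK ?expn_gt0 ?addn2 //; apply/eqP; ring.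
Qed.

(** If the class contains a vector [y] of [K], compare the exact sum of [hits] over the pencil of
    [y] with the upper bound from [hits_le]; [nbhd] is the only unknown. *)
Lemma nbhd_le v : v != 0 -> (nbhd v <= q * p * (q - 1) ^ 2)%N.
Proof.
move=> v0; have [t [Ep Eq Eq1 Eq2 Eq3]] := q_form.
rewrite /nbhd; have [->|[y]] := set_0Vmem [set x in K | (x.1 <= v)%MS].
  by rewrite cards0.
rewrite inE => /andP[yK yv]; have ny := subsetP Kunimod _ yK.
have -> : #|[set x in K | (x.1 <= v)%MS]| = nbhd y.1.
  apply: eq_card => x; rewrite !inE; case: (x \in K) => //=.
  rewrite inE in ny; have vy : (v <= y.1)%MS by rewrite submx_rV_sym.
  by apply/idP/idP => /submx_trans; apply.
have := sum_hits_pencil ny; rewrite yK cardK.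
have: (\sum_(a in [set a in unimod | inc a y]) hits a <=
   \sum_(a in [set a in unimod | inc a y]) q * (q - 1) * (q * p))%N.
  by apply: leq_sum => a; rewrite inE => /andP[/hits_le].
rewrite sum_nat_const card_pencil // => le E; move: le; rewrite {}E Eq1 Eq2 Eq3 Eq Ep.
set C := nbhd _ => le.
have e0 : (0 < (2 * t + 2) * (2 * t + 1) ^ 2)%N by rewrite addn1 addn2.
rewrite -(leq_pmul2l e0); lia.
Qed.

(** The sum of the upper bounds [nbhd_le] equals the total given by [sum_nbhd], so no class falls
    short. *)
Lemma nbhd_eq v : v != 0 -> nbhd v = (q * p * (q - 1) ^ 2)%N.
Proof.
move=> v0.
have le u : u \in [set u : 'rV[F]_3 | u != 0] -> (nbhd u <= q * p * (q - 1) ^ 2)%N.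
  by rewrite inE => /nbhd_le.
have [_] := leqif_sum (fun u nu => leqif_eq (le u nu)).
rewrite sum_nbhd sum_nat_const card_nonzero_rV cardK.
have -> : (q * (q - 1) * (p * (q ^ 3 - 1)) * (q - 1) =
  (q ^ 3 - 1) * (q * p * (q - 1) ^ 2))%N by ring.
by rewrite eqxx => /esym/forall_inP/(_ v); rewrite inE => /(_ v0)/eqP.
Qed.

(** With [nbhd_eq], the pencil sum at [y] reaches its upper bound, so every term does. *)
Lemma hits_eq a y : a \in unimod -> y \in K -> inc a y ->
  hits a = (q * (q - 1) * (q * p))%N.
Proof.
move=> na yK ay; have [t [Ep Eq Eq1 Eq2 Eq3]] := q_form; have ny := subsetP Kunimod _ yK.
have le b : b \in [set a in unimod | inc a y] -> (hits b <= q * (q - 1) * (q * p))%N.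
  by rewrite inE => /andP[/hits_le].
have [_] := leqif_sum (fun b nb => leqif_eq (le b nb)).
rewrite sum_hits_pencil // sum_nat_const card_pencil // yK cardK nbhd_eq; last first.
  by move: ny; rewrite inE.
set b := (_ == _); have -> : b by rewrite /b Eq1 Eq2 Eq3 Eq Ep; apply/eqP; rewrite mul1n; ring.
by move/esym/forall_inP/(_ a); rewrite inE na ay => /(_ isT)/eqP.
Qed.

Lemma hits_two a : a \in unimod -> a \notin passants ->
  hits a = (q * (q - 1) * (q * p))%N.
Proof.
move=> na; rewrite inE na /= /hits cards_eq0 => /set0Pn[y]; rewrite inE => /andP[yK ay].
exact: (hits_eq na yK ay).
Qed.

(** Since [hits] takes only two values, its sum over any family determines how many passants the
    family contains. *)
Lemma card_passants_in (D : {set W}) : D \subset unimod ->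
  (\sum_(a in D) hits a + #|D :&: passants| * (q * (q - 1) * (q * p))
   = #|D| * (q * (q - 1) * (q * p)))%N.
Proof.
move=> sD; rewrite (big_setID passants) /= big1 => [|a]; last first.
  by rewrite !inE => /and3P[_ _ /eqP].
rewrite (eq_bigr (fun=> q * (q - 1) * (q * p)))%N => [|a]; last first.
  by rewrite inE => /andP[nZ aD]; rewrite hits_two ?(subsetP sD).
by rewrite sum_nat_const add0n -mulnDl addnC cardsID.
Qed.

Lemma card_passants : #|passants| = (q * (q ^ 3 - 1))%N.
Proof.
have [t [Ep Eq Eq1 Eq2 Eq3]] := q_form; have := card_passants_in (subxx unimod).
have -> : unimod :&: passants = passants.
  by apply/setIidPr/subsetP=> a; rewrite inE => /andP[].
rewrite sum_hits (eq_bigr (fun=> (q ^ 2 - 1) * q ^ 2))%N; last first.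
  by move=> x xK; rewrite card_pencil ?(subsetP Kunimod).
rewrite sum_nat_const cardK card_unimod Eq1 Eq2 Eq3 Eq Ep => E.
have e0 : (0 < (2 * t + 2) * (2 * t + 1) * ((2 * t + 2) * t.+1))%N by rewrite addn1 addn2.
apply/eqP; rewrite -(eqn_pmul2r e0); apply/eqP.
by apply: addnI (etrans E _); ring.
Qed.

(** Off [K] the pencil sum lacks the term [q ^ 4 * (q - 1) ^ 2]. As q = 2p, this is
    [2 * q * (q - 1)] times the common nonzero value of [hits], hence two passants. *)
Lemma card_passants_thru y : y \in unimod ->
  #|[set a in passants | inc a y]| = ((y \notin K) * (2 * q * (q - 1)))%N.
Proof.
move=> ny; have [t [Ep Eq Eq1 Eq2 Eq3]] := q_form.
have sD : [set a in unimod | inc a y] \subset unimod.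
  by apply/subsetP=> a; rewrite inE => /andP[].
have := card_passants_in sD.
have -> : [set a in unimod | inc a y] :&: passants = [set a in passants | inc a y].
  by apply/setP=> a; rewrite !inE; case: (a.1 != 0); rewrite //= andbC.
rewrite sum_hits_pencil // card_pencil // nbhd_eq; last by move: ny; rewrite inE.
rewrite cardK Eq1 Eq2 Eq3 Eq Ep => E.
have e0 : (0 < (2 * t + 2) * (2 * t + 1) * ((2 * t + 2) * t.+1))%N by rewrite addn1 addn2.
apply/eqP; rewrite -(eqn_pmul2r e0); apply/eqP.
by apply: addnI (etrans E _); case: (y \in K); rewrite /= ?mul0n ?mul1n; ring.
Qed.

(** Incidence with [(v, 0)] says that [v] is orthogonal to [a.1] and that [v^s] is orthogonal to
    [a.2]. These conditions coincide or are independent, giving q + 1 or 1 subplane points, each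
    with q - 1 generators over the field. *)
Lemma card_subplane a : a \in unimod ->
  #|[set v : 'rV[F]_3 | (v != 0) && inc a (v, 0)]|
  = ((q - 1) * (1 + (a.2 <= a.1^s)%MS * q))%N.
Proof.
case: a => a0 a1; rewrite inE /= => na; have [t st ts] := s_bij.
(* Surjectivity of [s] allows both conditions to be written on [v] itself. *)
have [b ->] : exists b, a1 = b^s.
  by exists (map_mx t a1); apply/rowP=> i; rewrite !mxE ts.
have -> : [set v | (v != 0) && inc (a0, b^s) (v, 0)] =
   [set v | [&& v != 0, v *m a0^T == 0 & v *m b^T == 0]].
  apply/setP=> v; rewrite !inE /inc /= trmx0 mulmx0 add0r map_trmx -map_mxM map_mx_eq0.
  by rewrite orthC (orthC b).
rewrite map_submx; have [ba|ba] := boolP (b <= a0)%MS; last first.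
  by rewrite card_orth2 // addn0 muln1.
rewrite (_ : [set _ | _] = [set v | (v != 0) && (v *m a0^T == 0)]).
  by rewrite card_orth1 // mul1n (subn_sqr q 1) [(1 + q)%N]addnC.
apply/setP=> v; rewrite !inE; case: (v != 0) => //=.
by apply: andb_idr => /eqP va; rewrite (orth_submx ba va).
Qed.

Lemma hits_shift u w d : hits (u, w + d *: u^s) = hits (u, w).
Proof. by apply: eq_card => x; rewrite !inE inc_shift. Qed.

(* [(u, d u^s)] is the left multiple of [(u, 0)] by [1 + d X], so the passants
   meeting the subplane in [q + 1] points come in groups of [q] covectors. *)
Lemma card_subplane_passants :
  #|[set a in passants | (a.2 <= a.1^s)%MS]| =
  (q * #|[set u : 'rV[F]_3 | (u, 0%R) \in passants]|)%N.
Proof.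
rewrite -cardsT -cardsX.
pose f (w : F * 'rV[F]_3) : W := (w.2, w.1 *: w.2^s).
have f_passant d u : (f (d, u) \in passants) = ((u, 0) \in passants).
  by rewrite !inE /f /= -[d *: _]add0r hits_shift.
rewrite -[RHS](card_in_imset (f := f)).
  apply: eq_card => a; apply/setIdP/imsetP.
    case: a => u w /= [aZ /sub_rVP[d Ew]].
    exists (d, u); last by rewrite Ew.
    by rewrite in_setX in_setT in_set -(f_passant d) /f /= -Ew.
  case=> [[d u]]; rewrite in_setX in_setT in_set /= => uZ ->.
  by rewrite f_passant scalemx_sub.
move=> [d u] [d' u'] /=; rewrite in_setX in_setT in_set /= => uZ _ [<- /eqP].
rewrite -subr_eq0 -scalerBl scaler_eq0 map_mx_eq0 subr_eq0.
by move: uZ; rewrite !inE => /andP[/negPf-> _]; rewrite orbF => /eqP->.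
Qed.

Lemma no_arc_of_vectors : False.
Proof.
have [t [Ep Eq Eq1 Eq2 Eq3]] := q_form.
have E : (\sum_(v : 'rV[F]_3 | v != 0%R) #|[set a in passants | inc a (v, 0%R)]| =
  \sum_(a in passants) #|[set v : 'rV[F]_3 | (v != 0%R) && inc a (v, 0%R)]|)%N.
  under eq_bigr => v _ do rewrite -sum1dep_card big_mkcondr /=.
  rewrite exchange_big /=; apply: eq_bigr => x _.
  by rewrite -big_mkcondr sum1dep_card.
move: E.
rewrite (eq_bigr (fun v => ((v, 0%R) \notin K) * (2 * q * (q - 1))))%N; last first.
  by move=> v v0; rewrite card_passants_thru ?inE.
rewrite -big_distrl /=; set w := (\sum_(_ | _) _)%N.
rewrite (eq_bigr (fun a => (q - 1) + (a.2 <= a.1^s)%MS * ((q - 1) * q)))%N; last first.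
  move=> a; rewrite inE => /andP[na _]; rewrite card_subplane //.
  by rewrite mulnDr muln1 mulnCA.
rewrite big_split /= sum_nat_const card_passants -big_distrl /=.
have -> : (\sum_(a in passants) (a.2 <= a.1^s)%MS =
           #|[set a in passants | (a.2 <= a.1^s)%MS]|)%N.
  by rewrite -sum1dep_card big_mkcondr; apply: eq_bigr => x _; case: (_ <= _)%MS.
(* Cancelling q(q - 1) will leave 2w = (q^3 - 1) + qz; as q is even, the parity of the right side
   does not depend on [z]. *)
rewrite card_subplane_passants; set z := #|[set _ | _]|.
rewrite Eq1 Eq3 Eq => E.
have e0 : (0 < (2 * t + 2) * (2 * t + 1))%N by rewrite addn1 addn2.
(* The right-hand side is odd. *)
have : (2 * w == (2 * t + 1) * ((2 * t + 2) ^ 2 + (2 * t + 2) + 1) + (2 * t + 2) * z)%N.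
  rewrite -(eqn_pmul2r e0); apply/eqP; lia.
move/eqP; lia.
Qed.

End Arc.
End Hjelmslev.

(** * Translation between submodules of the plane and their vectors and covectors *)

Section Plane.
Variables (F : finFieldType) (s : {rmorphism F -> F}).
Local Notation q := #|F|.
Local Notation W := ('rV[F]_3 * 'rV[F]_3)%type.

Definition vec_of_pair (w : W) : vec F := [ffun i => (w.1 0 i, w.2 0 i)].
Definition pair_of_vec (v : vec F) : W := (\row_i (v i).1, \row_i (v i).2).

Lemma vec_of_pairK : cancel vec_of_pair pair_of_vec.
Proof.
by case=> w0 w1; congr pair; apply/rowP=> i; rewrite mxE ffunE.
Qed.

Lemma pair_of_vecK : cancel pair_of_vec vec_of_pair.
Proof. by move=> v; apply/ffunP=> i; rewrite ffunE !mxE; case: (v i). Qed.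

Lemma vscaleE w r : vscale s (vec_of_pair w) r = vec_of_pair (wact s w r).
Proof.
apply/ffunP=> i; rewrite !ffunE /Rmul /= !mxE.
by rewrite [r.1 * _]mulrC [r.2 * _]mulrC [s _ * _]mulrC.
Qed.

Lemma wactM w r t : wact s (wact s w r) t = wact s w (Rmul s r t).
Proof.
case: w r t => w0 w1 [c d] [c' d']; rewrite /wact /Rmul /= rmorphM.
congr pair; first by rewrite scalerA mulrC.
rewrite !scalerDr !scalerA scalerDl [s c' * s c]mulrC addrA.
by rewrite [d' * c]mulrC [s c' * d]mulrC.
Qed.

Lemma wact1 w : wact s w (1, 0) = w.
Proof. by case: w => a b; rewrite /wact /= rmorph1 !scale1r scale0r add0r. Qed.

Lemma inc_wact a w r : inc s a w -> inc s a (wact s w r).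
Proof.
case: a w r => a0 a1 [w0 w1] [c d] /andP[/= /eqP E0 /eqP E1]; rewrite /inc /=.
rewrite map_mxZ linearD !linearZ /= mulmxDr -!scalemxAr E0 !scaler0 add0r eqxx /=.
by rewrite -scalerDr E1 scaler0.
Qed.

Lemma inc_add a w w' : inc s a w -> inc s a w' -> inc s a (w.1 + w'.1, w.2 + w'.2).
Proof.
case: a w w' => a0 a1 [w0 w1] [v0 v1] /andP[/= /eqP E0 /eqP E1] /andP[/= /eqP E2 /eqP E3].
by rewrite /inc /= map_mxD !linearD /= E0 E2 addrACA E1 E3 !addr0 eqxx.
Qed.

Definition gen (w : W) : {set vec F} :=
  [set vscale s (vec_of_pair w) r | r : (F * F)%type].

Lemma is_point_gen P : is_point s P -> exists2 w, w \in unimod F & P = gen w.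
Proof.
case=> x [inj ->]; exists (pair_of_vec x); last by rewrite /gen pair_of_vecK.
rewrite inE; apply/eqP => x0.
(* The pair [(0, 1)] is X, which annihilates every vector whose first component vanishes. *)
have : (0 : F, 1 : F) = (0, 0).
  apply: inj; rewrite -[x]pair_of_vecK !vscaleE; congr vec_of_pair.
  by rewrite /wact x0 /= !scaler0.
by case=> /eqP; rewrite oner_eq0.
Qed.

Lemma gen_wact w r : r.1 != 0 -> gen (wact s w r) = gen w.
Proof.
move=> r0; apply/setP=> v; apply/imsetP/imsetP=> -[t _ ->].
  by exists (Rmul s r t) => //; rewrite !vscaleE wactM.
pose c := r.1^-1 * t.1.
(* This is the product of the inverse of [r] with [t] in R, obtained by solving [Rmul]
   componentwise. *)
exists (c, r.1^-1 * (t.2 - r.2 * s c)) => //.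
rewrite !vscaleE wactM /Rmul /= /c !mulVKf // subrK.
by case: t {c}.
Qed.

Lemma gen_eq_same w w' : w' \in unimod F -> (gen w' == gen w) = same s w w'.
Proof.
move=> nw'; apply/eqP/existsP=> [E|[r /andP[r0 /eqP->]]]; last exact: gen_wact.
have : vec_of_pair w' \in gen w.
  by rewrite -E; apply/imsetP; exists (1, 0) => //; rewrite vscaleE wact1.
case/imsetP=> r _; rewrite vscaleE => /(can_inj vec_of_pairK) Er.
exists r; rewrite Er eqxx andbT; apply: contraTneq nw' => r0.
by rewrite inE Er /= r0 scale0r eqxx.
Qed.

(** The fibres of [gen] over points are the classes of [same], each of size [q * (q - 1)]. *)
Lemma card_gens (A : {set {set vec F}}) (Q : pred {set vec F}) :
  (forall P, P \in A -> is_point s P) ->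
  #|[set w in unimod F | (gen w \in A) && Q (gen w)]|
  = (q * (q - 1) * #|[set P in A | Q P]|)%N.
Proof.
move=> Apt; rewrite -sum1dep_card (partition_big gen (mem [set P in A | Q P])) /=.
  rewrite mulnC -sum_nat_const; apply: eq_bigr => P; rewrite inE => /andP[PA QP].
  have [w0 nw0 EP] := is_point_gen (Apt _ PA); rewrite -(card_same s nw0) sum1dep_card.
  apply: eq_card => w; rewrite !inE; case nw: (w.1 != 0) => /=.
    rewrite -gen_eq_same ?inE // -EP; case: eqP => [->|]; rewrite ?andbF //.
    by rewrite PA QP.
  apply/esym/negbTE; apply: contraFN nw => /existsP[r /andP[r0 /eqP->]].
  by rewrite inE in nw0; rewrite scaler_eq0 negb_or r0.
by move=> w /andP[_ H]; rewrite inE.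
Qed.

Definition line_of (a : W) : {set vec F} := [set v | inc s a (pair_of_vec v)].

Lemma gen_sub_line a w : (gen w \subset line_of a) = inc s a w.
Proof.
apply/subsetP/idP=> [sub|aw v /imsetP[r _ ->]].
  have := sub (vec_of_pair w); rewrite inE vec_of_pairK; apply.
  by apply/imsetP; exists (1, 0) => //; rewrite vscaleE wact1.
by rewrite inE vscaleE vec_of_pairK inc_wact.
Qed.

Lemma card_line_of a : a \in unimod F -> #|line_of a| = (q ^ 2 * q ^ 2)%N.
Proof.
case: a => a0 a1; rewrite inE /= => na.
rewrite -(card_imset _ (can_inj pair_of_vecK)).
rewrite (_ : _ @: _ = [set w | inc s (a0, a1) w]); last first.
  apply/setP=> w; rewrite inE; apply/imsetP/idP=> [[v]|aw].
    by rewrite inE => H ->.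
  by exists (vec_of_pair w); rewrite ?inE vec_of_pairK.
rewrite -{1}(card_affine1 0 na).
rewrite (card_pair_set (m := (q ^ 2)%N) (Q := fun u => u *m a0^T == 0)) //.
  (* For a fixed first component the second one solves a single affine equation; the transposes
     exchange the two factors. *)
  move=> u ua; rewrite -(card_affine1 (- (a1 *m (map_mx s u)^T))^T na).
  apply: eq_card => v; rewrite !inE /inc /= orthC ua /= addr_eq0.
  by rewrite -[in RHS](inj_eq (@trmx_inj _ _ _)) trmx_mul !trmxK.
by move=> u v; rewrite /inc /= orthC => /andP[].
Qed.

Lemma inc_lift a u : a \in unimod F -> a.1 *m u^T = 0 -> exists w, inc s a (u, w).
Proof.
rewrite inE => na au.
have /card_gt0P[w] : (0 < #|[set w : 'rV_3 | w *m a.1^T == (- (a.2 *m (map_mx s u)^T))^T]|)%N.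
  by rewrite card_affine1 // expn_gt0 (cardD1 0).
rewrite inE => /eqP E; exists w; rewrite /inc /= au eqxx /=.
by rewrite -[a.1 *m _]trmxK trmx_mul trmxK E trmxK addNr.
Qed.

Lemma free2_coefs n (x y : 'rV[F]_n) c d : x != 0 -> ~~ (y <= x)%MS ->
  c *: x + d *: y = 0 -> c = 0 /\ d = 0.
Proof.
move=> nx xy E; have d0 : d = 0.
  apply: contraNeq xy => d0; apply/sub_rVP; exists (- (d^-1 * c)).
  move/eqP: E; rewrite addrC addr_eq0 => /eqP E.
  by rewrite scaleNr -scalerA -scalerN -E scalerA mulVf ?scale1r.
move/eqP: E; rewrite d0 scale0r addr0 scaler_eq0 (negPf nx) orbF.
by move/eqP.
Qed.

(** The orthogonal space has q^2 vectors, too many to be multiples of a single [x]. *)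
Lemma orth_basis (a : 'rV[F]_3) : a != 0 -> exists x y : 'rV[F]_3,
  [/\ x != 0, ~~ (y <= x)%MS, a *m x^T = 0 & a *m y^T = 0].
Proof.
move=> na; have q1 : (1 < q)%N by apply: finNzRing_gt1.
have /card_gt0P[x] : (0 < #|[set u : 'rV_3 | (u != 0%R) && (u *m a^T == 0%R)]|)%N.
  by rewrite card_orth1 // subn_gt0 -{1}(exp1n 2) ltn_exp2r.
rewrite inE => /andP[nx xa].
have /subsetPn[y] : ~~ ([set u : 'rV_3 | u *m a^T == 0] \subset [set u | (u <= x)%MS]).
  apply/negP=> /subset_leq_card; rewrite card_affine1 // card_submx_rV //.
  by rewrite leqNgt -{1}(expn1 q) ltn_exp2l.
rewrite !inE => ya yx; exists x, y; split=> //; by apply/eqP; rewrite orthC.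
Qed.

(** A basis orthogonal to [a.1] lifts by [inc_lift] to two vectors of the kernel of [a]. Their
    combinations number q^4, which is the size of the kernel, so inclusion becomes equality. *)
Lemma line_of_is_line a : a \in unimod F -> is_line s (line_of a).
Proof.
move=> na; have na0 := na; rewrite inE in na0.
have [x0 [y0 [nx xy ax ay]]] := orth_basis na0.
have [[x1 ix] [y1 iy]] := (inc_lift na ax, inc_lift na ay).
have lineE rr : line_map s (vec_of_pair (x0, x1)) (vec_of_pair (y0, y1)) rr =
  vec_of_pair ((wact s (x0, x1) rr.1).1 + (wact s (y0, y1) rr.2).1,
               (wact s (x0, x1) rr.1).2 + (wact s (y0, y1) rr.2).2).
  by rewrite /line_map !vscaleE; apply/ffunP=> i; rewrite !ffunE /Radd /= !mxE.
have inj : injective (line_map s (vec_of_pair (x0, x1)) (vec_of_pair (y0, y1))).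
  move=> [[c d] [c' d']] [[e f] [e' f']]; rewrite !lineE => /(can_inj vec_of_pairK).
  case=> /= E1 E2.
  have [/subr0_eq Ec /subr0_eq Ec'] : c - e = 0 /\ c' - e' = 0.
    apply: (free2_coefs nx xy); rewrite !scalerBl addrACA -opprD E1 subrr //.
  subst e e'.
  (* Once the leading coefficients agree, the terms in [x1] and [y1] cancel, and independence of
     [x0] and [y0] applies again. *)
  have [/subr0_eq-> /subr0_eq->] // : d - f = 0 /\ d' - f' = 0.
  apply: (free2_coefs nx xy); rewrite !scalerBl addrACA -opprD.
  move: E2; rewrite addrACA [RHS]addrACA => /addIr->.
  by rewrite subrr.
exists (vec_of_pair (x0, x1)), (vec_of_pair (y0, y1)); split=> //.
apply/esym/eqP; rewrite eqEcard card_line_of // card_imset //; apply/andP; split.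
  apply/subsetP=> v /imsetP[rr _ ->]; rewrite inE lineE vec_of_pairK.
  by apply: inc_add; apply: inc_wact.
by rewrite !card_prod.
Qed.

End Plane.

Theorem theorem3p12 (F : finFieldType) (r : nat) (s : {rmorphism F -> F}) :
  (0 < r)%N -> #|F| = (2 ^ r)%N -> bijective s ->
  ~ (exists A : {set {set vec F}},
       is_proj_arc s A (((2 ^ r) ^ 4 - 2 ^ r) %/ 2) ((2 ^ r) ^ 2 %/ 2)).
Proof.
case: r => // r _ Fq s_bij [A [Apt cardA A_line]].
have qE : #|F| = (2 * 2 ^ r)%N by rewrite Fq expnS.
have kE : (((2 ^ r.+1) ^ 4 - 2 ^ r.+1) %/ 2 = 2 ^ r * (#|F| ^ 3 - 1))%N.
  rewrite -Fq (_ : #|F| ^ 4 - #|F| = #|F| * (#|F| ^ 3 - 1))%N; last first.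
    by rewrite mulnBr muln1 -expnS.
  by rewrite {1}qE -mulnA mulKn.
have nE : ((2 ^ r.+1) ^ 2 %/ 2 = #|F| * 2 ^ r)%N.
  by rewrite -Fq expnS expn1 {1}qE -mulnA mulKn // mulnC.
(* All generators of the arc points: [Kgens] scales both the size of [A] and its line intersections
   by [q * (q - 1)]. *)
pose K := [set w in unimod F | gen s w \in A].
have Kgens Q : #|[set w in K | Q (gen s w)]| = (#|F| * (#|F| - 1) * #|[set P in A | Q P]|)%N.
  by rewrite -(card_gens Q Apt); apply: eq_card => w; rewrite !inE andbA.
apply: (@no_arc_of_vectors F s K _ _ s_bij (2 ^ r) qE).
- by apply/subsetP=> w; rewrite inE => /andP[].
- by move=> x t t0; rewrite !inE gen_wact // scaler_eq0 negb_or t0.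
- have := Kgens predT; rewrite -kE -cardA.
  have -> : [set P in A | predT P] = A by apply/setP=> P; rewrite inE /= andbT.
  by move=> <-; apply: eq_card => w; rewrite !inE /= andbT.
move=> a na; rewrite -nE.
rewrite (leq_trans _ (leq_mul (leqnn _) (A_line _ (line_of_is_line s na)))) //.
rewrite -(Kgens (fun P => P \subset line_of s a)).
by apply/eq_leq/eq_card => w; rewrite !inE gen_sub_line.
Qed.
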